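(* Let $A$ and $B$ be real symmetric positive definite $N\times N$ matrices, and assume there exist real numbers $\alpha,\beta>0$ such that $$\alpha\langle Bu,u\rangle\le\langle Au,u\rangle\le\beta\langle Bu,u\rangle\qquad\forall u\in\mathbb{R}^N .$$ Let $\tau>0$ and consider, for a time step $\Delta t>0$, the scheme $$\frac{u^{(k+1)}-u^{(k)}}{\Delta t}+\tau B\,(u^{(k+1)}-u^{(k)})=-Au^{(k)},\qquad k\ge 0,\quad u^{(0)}\in\mathbb{R}^N .$$ Then: (1) if $\tau\ge\frac{\beta}{2}$, the scheme is unconditionally stable, i.e. stable for every $\Delta t>0$; (2) if $\tau<\frac{\beta}{2}$, the scheme is stable for every $\Delta t$ with $$0<\Delta t<\frac{2}{\left(1-\frac{2\tau}{\beta}\right)\rho(A)} .$$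
   Context: $\langle\cdot,\cdot\rangle$ is the Euclidean scalar product on $\mathbb{R}^N$ and $\rho(A)$ is the spectral radius of $A$. ''Stable'' means energy stability in the $A$-norm: for every initial vector $u^{(0)}$ and every $k\ge0$ with $u^{(k+1)}\neq u^{(k)}$ one has $\langle Au^{(k+1)},u^{(k+1)}\rangle<\langle Au^{(k)},u^{(k)}\rangle$. *)

(* Defs.v *)
From HB Require Import structures.
From mathcomp Require Import all_boot all_order all_algebra.
From mathcomp Require Import all_classical all_reals.
From mathcomp Require Import complex.
Set Implicit Arguments.
Unset Strict Implicit.
Unset Printing Implicit Defensive.
Import Order.TTheory GRing.Theory Num.Theory.
Local Open Scope classical_set_scope.
Local Open Scope ring_scope.

Definition dotv (R : realType) (n : nat) (u v : 'cV[R]_n) : R :=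
  \sum_(i < n) u i ord0 * v i ord0.

Definition sym_posdef (R : realType) (n : nat) (A : 'M[R]_n) : Prop :=
  A^T = A /\ forall u : 'cV[R]_n, u != 0 -> 0 < dotv (A *m u) u.

(* The spectrum is taken over R[i], so non-real eigenvalues are not missed.
   For n = 0 the spectrum is empty and the supremum is 0. *)
Definition spectral_radius (R : realType) (n : nat) (A : 'M[R]_n) : R :=
  sup [set ComplexField.Normc.normc z | z in
        [set z : R[i] | eigenvalue (map_mx (real_complex R) A) z]].

Definition scheme (R : realType) (n : nat) (A B : 'M[R]_n) (tau dt : R)
    (u : nat -> 'cV[R]_n) : Prop :=
  forall k : nat,
    dt^-1 *: (u k.+1 - u k) + tau *: (B *m (u k.+1 - u k)) = - (A *m u k).

(* The initial vector is u 0; [scheme_wf] below shows that each initial vector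
   determines exactly one solution. *)
Definition stable (R : realType) (n : nat) (A B : 'M[R]_n) (tau dt : R)
  : Prop :=
  forall u : nat -> 'cV[R]_n, scheme A B tau dt u ->
  forall k : nat, u k.+1 != u k ->
    dotv (A *m u k.+1) (u k.+1) < dotv (A *m u k) (u k).

Lemma scheme_wf (R : realType) (n : nat) (A B : 'M[R]_n) (tau dt : R)
    (u0 : 'cV[R]_n) :
  sym_posdef B -> 0 < tau -> 0 < dt ->
  exists! u : nat -> 'cV[R]_n, u 0%N = u0 /\ scheme A B tau dt u.
Proof.
move=> [_ Bpos] tau0 dt0.
pose M := dt^-1%:M + tau *: B.
have ME (d : 'cV[R]_n) : M *m d = dt^-1 *: d + tau *: (B *m d).
  by rewrite mulmxDl mul_scalar_mx scalemxAl.
have Minj (d : 'cV[R]_n) : M *m d = 0 -> d = 0.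
  move=> Md; apply/eqP; apply: contraT => d0.
  have : 0 < dotv (M *m d) d.
    rewrite ME; have -> : dotv (dt^-1 *: d + tau *: (B *m d)) d
        = dt^-1 * dotv d d + tau * dotv (B *m d) d.
      rewrite /dotv !mulr_sumr -big_split; apply: eq_bigr => i _ /=.
      by rewrite 2![in LHS]mxE [(_ *: (B *m d)) _ _]mxE mulrDl !mulrA.
    rewrite ltr_wpDl ?mulr_gt0 ?Bpos // mulr_ge0 ?invr_ge0 ?(ltW dt0) //.
    by apply: sumr_ge0 => i _; rewrite -expr2 sqr_ge0.
  rewrite Md (_ : dotv 0 d = 0) ?ltxx // /dotv big1 // => i _.
  by rewrite mxE mul0r.
have Munit : M \in unitmx.
  rewrite -unitmx_tr -row_free_unit -kermx_eq0; apply/eqP/row_matrixP => i.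
  rewrite row0; apply: trmx_inj; rewrite trmx0; apply: Minj.
  by apply: trmx_inj; rewrite trmx_mul trmxK trmx0 -row_mul mulmx_ker row0.
pose step (v : 'cV[R]_n) := v + invmx M *m (- (A *m v)).
exists (fun k => iter k step u0); split.
  by split=> // k; rewrite -ME iterS /step addrC addKr mulKVmx.
move=> v [v0 sv]; apply: funext; elim=> [|k IH]; first by rewrite v0.
by rewrite iterS IH /step -sv -ME mulKmx // addrC subrK.
Qed.

(* Main.v *)
(** Put [d = u (k+1) - u k].  Pairing the scheme with [d] gives
    [<A u(k+1), u(k+1)> - <A u(k), u(k)>
       = <A d, d> - 2 tau <B d, d> - (2 / dt) <d, d>].
    Since [<B d, d> >= <A d, d> / beta], the right-hand side is at most
    [(1 - 2 tau / beta) <A d, d> - (2 / dt) <d, d>]; it is negative at once if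
    [1 - 2 tau / beta <= 0], and otherwise by [<A d, d> <= rho(A) <d, d>] and
    the bound on [dt]. *)
Require Import Defs.
From HB Require Import structures.
From mathcomp Require Import all_boot all_order all_algebra.
From mathcomp Require Import all_classical all_reals.
From mathcomp Require Import complex ring lra.
Set Implicit Arguments.
Unset Strict Implicit.
Unset Printing Implicit Defensive.
Import Order.TTheory GRing.Theory Num.Theory.
Local Open Scope ring_scope.

Section DotProduct.
Variables (R : realType) (n : nat).
Implicit Types (u v w : 'cV[R]_n) (A : 'M[R]_n).

Lemma dotvE u v : dotv u v = (u^T *m v) 0 0.
Proof. by rewrite /dotv mxE; apply: eq_bigr => i _; rewrite mxE. Qed.

Lemma dotvC u v : dotv u v = dotv v u.
Proof. by apply: eq_bigr => i _; rewrite mulrC. Qed.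

Lemma dotvDl u v w : dotv (u + v) w = dotv u w + dotv v w.
Proof. by rewrite !dotvE linearD mulmxDl mxE. Qed.

Lemma dotvZl a u v : dotv (a *: u) v = a * dotv u v.
Proof. by rewrite !dotvE linearZ -scalemxAl mxE. Qed.

Lemma dotvNl u v : dotv (- u) v = - dotv u v.
Proof. by rewrite -scaleN1r dotvZl mulN1r. Qed.

Lemma dotvDr u v w : dotv u (v + w) = dotv u v + dotv u w.
Proof. by rewrite !(dotvC u) dotvDl. Qed.

Lemma dotv_mulmx_sym A u v : A^T = A -> dotv (A *m u) v = dotv (A *m v) u.
Proof. by move=> As; rewrite dotvC !dotvE trmx_mul As mulmxA. Qed.

Lemma dotv_gt0 u : u != 0 -> 0 < dotv u u.
Proof.
move=> u0; have ge0 i : true -> 0 <= u i ord0 * u i ord0.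
  by rewrite -expr2 sqr_ge0.
rewrite lt0r sumr_ge0 // andbT; apply: contra u0; rewrite psumr_eq0 //.
move=> /allP z; apply/eqP/colP => i; rewrite mxE; apply/eqP.
by have := z i (mem_index_enum i); rewrite mulf_eq0 orbb.
Qed.

End DotProduct.

(** A [sup] dominates the members of a set only once the set is bounded above. The eigenvalues are
    roots of the characteristic polynomial, which splits over [R[i]], so the sum of the moduli of
    its roots is a bound. *)
Lemma eigenvalue_le_spectral_radius (R : realType) (n : nat) (A : 'M[R]_n)
    (z : R[i]) :
  eigenvalue (map_mx (real_complex R) A) z ->
  ComplexField.Normc.normc z <= spectral_radius A.
Proof.
move=> Az; apply: ub_le_sup; last by exists z.
have [rs pE] := closed_field_poly_normal (char_poly (map_mx (real_complex R) A)).
exists (\sum_(r <- rs) ComplexField.Normc.normc r) => _ [y /= Ay <-].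
move: Ay; rewrite eigenvalue_root_char pE (monicP (char_poly_monic _)) scale1r.
rewrite root_prod_XsubC => yrs; rewrite (big_rem y) //= lerDl.
by apply: sumr_ge0 => -[a b] _; apply: sqrtr_ge0.
Qed.

(** From [M = P^-1 D P] follows [P M = D P], so row [i] of [P] is a left eigenvector, nonzero
    because [P] is invertible. *)
Lemma eigenvalue_spectral_diag (C : numClosedFieldType) (n : nat) (M : 'M[C]_n)
    (i : 'I_n) :
  M \is normalmx -> eigenvalue M (spectral_diag M 0 i).
Proof.
move=> /orthomx_spectralP ME; have Pu := spectral_unit M.
apply/eigenvalueP; exists (row i (spectralmx M)).
  rewrite -row_mul {2}ME !mulmxA mulmxV // mul1mx row_mul row_diag_mx.
  by rewrite -scalemxAl -rowE.
apply: contraTneq isT => Pi.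
have := congr1 (fun v => (v *m invmx (spectralmx M)) 0 i) Pi.
rewrite -row_mul mulmxV // mul0mx !mxE eqxx => /eqP.
by rewrite oner_eq0.
Qed.

(** In a unitary eigenbasis over [R[i]] both sides become sums over [|w_i|^2]. The weights on the
    left are the eigenvalues, which are real and hence at most their moduli. *)
Lemma dotv_mulmx_le_spectral_radius (R : realType) (n : nat) (A : 'M[R]_n)
    (u : 'cV[R]_n) :
  A^T = A -> dotv (A *m u) u <= spectral_radius A * dotv u u.
Proof.
move=> As; pose toC := real_complex R.
pose M := map_mx toC A; pose v := map_mx toC u.
have toC_conj x : (toC x)^* = toC x by apply/CrealP/complex_realP; exists x.
have Mherm : M \is hermsymmx.
  apply: realsym_hermsym.
    by apply/is_hermitianmxP; rewrite expr0 scale1r map_mx_id // map_trmx As.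
  by apply/mxOverP => i j; rewrite mxE; apply/complex_realP; exists (A i j).
have Mn := hermitian_normalmx Mherm.
have PU := spectral_unitarymx M.
pose P := spectralmx M; have [w wE] : {w | w = P *m v} by exists (P *m v).
(* As [u] is real, the transpose of [v] is its adjoint; unitarity of [P] then gives
   [v^* = w^* P]. *)
have vE : v^T = map_mx Num.conj w^T *m P.
  rewrite wE trmx_mul map_mxM mulmxKtV //; apply/rowP => i.
  by rewrite !mxE; symmetry; apply: toC_conj.
have dE : toC (dotv u u) = \sum_i `|w i 0| ^+ 2.
  have -> : toC (dotv u u) = (v^T *m v) 0 0.
    by rewrite dotvE map_trmx -map_mxM [RHS]mxE.
  rewrite vE -mulmxA -wE mxE; apply: eq_bigr => i _.
  by rewrite !mxE mulrC -normCK.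
have AE : toC (dotv (A *m u) u) = \sum_i spectral_diag M 0 i * `|w i 0| ^+ 2.
  have -> : toC (dotv (A *m u) u) = (v^T *m (M *m v)) 0 0.
    by rewrite dotvC dotvE map_trmx -!map_mxM [RHS]mxE.
  have -> : M *m v = invmx P *m diag_mx (spectral_diag M) *m w.
    by rewrite wE mulmxA -(orthomx_spectralP Mn).
  rewrite vE !mulmxA mulmxK ?spectral_unit // -mulmxA mul_diag_mx mxE.
  apply: eq_bigr => i _; rewrite !mxE normCK; ring.
rewrite -lecR [leLHS]AE rmorphM [X in _ * X]dE mulr_sumr; apply: ler_sum => i _.
apply: ler_wpM2r; first exact: exprn_ge0.
have /mxOverP sr := hermitian_spectral_diag_real Mherm.
apply: (le_trans (real_ler_norm (sr 0 i))).
rewrite normc_def lecR.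
have := eigenvalue_le_spectral_radius (eigenvalue_spectral_diag i Mn).
by case: (spectral_diag M 0 i).
Qed.

(** Expanding the energy at [u k + d], symmetry of [A] merges the cross terms into [2 <A u(k), d>],
    which the scheme paired with [d] evaluates. *)
Lemma scheme_energy_step (R : realType) (n : nat) (A B : 'M[R]_n) (tau dt : R)
    (u : nat -> 'cV[R]_n) (k : nat) (d := u k.+1 - u k) :
  A^T = A -> scheme A B tau dt u ->
  dotv (A *m u k.+1) (u k.+1) = dotv (A *m u k) (u k)
    + (dotv (A *m d) d - 2 * tau * dotv (B *m d) d - 2 * dt^-1 * dotv d d).
Proof.
move=> As /(_ k); rewrite -/d => /(congr1 (fun v => dotv v d)).
rewrite dotvDl !dotvZl dotvNl => dE.
have uE : u k.+1 = u k + d by rewrite /d addrC subrK.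
clearbody d; rewrite uE mulmxDr !dotvDl !dotvDr (dotv_mulmx_sym d (u k) As).
lra.
Qed.

Theorem proposition2p1 (R : realType) (N : nat) (A B : 'M[R]_N)
    (alpha beta tau : R)
    (hA : sym_posdef A) (hB : sym_posdef B)
    (halpha : 0 < alpha) (hbeta : 0 < beta)
    (hAB : forall u : 'cV[R]_N,
       alpha * dotv (B *m u) u <= dotv (A *m u) u /\
       dotv (A *m u) u <= beta * dotv (B *m u) u)
    (htau : 0 < tau) :
  (beta / 2 <= tau ->
     forall dt : R, 0 < dt -> stable A B tau dt) /\
  (tau < beta / 2 ->
     forall dt : R, 0 < dt ->
       dt < 2 / ((1 - 2 * tau / beta) * spectral_radius A) ->
       stable A B tau dt).
Proof.
have [As _] := hA; have [_ Bpos] := hB.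
split=> htb dt dt0.
  move=> u su k uk; rewrite (scheme_energy_step k As su).
  set d := u k.+1 - u k; have d0 : d != 0 by rewrite subr_eq0.
  have [_ Ad] := hAB d; have Bd := Bpos d d0.
  have : 0 < dt^-1 * dotv d d by rewrite mulr_gt0 ?invr_gt0 ?dotv_gt0.
  (* Together with [Ad] this gives [<A d, d> <= 2 tau <B d, d>]; the [dt] term makes the decrease
     strict. *)
  have : 0 <= (2 * tau - beta) * dotv (B *m d) d by rewrite mulr_ge0 ?(ltW Bd) //; lra.
  lra.
set c := 1 - 2 * tau / beta; set r := spectral_radius A => dtr u su k uk.
rewrite (scheme_energy_step k As su).
set d := u k.+1 - u k; have d0 : d != 0 by rewrite subr_eq0.
have cE : c * beta = beta - 2 * tau by rewrite /c; field; rewrite gt_eqF.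
have c0 : 0 < c by rewrite -(pmulr_lgt0 _ hbeta) cE; lra.
(* Positivity is read off from [0 < dt < 2 / (c * r)]. Since [0^-1 = 0], no [dt] satisfies the bound
   when [r = 0]. *)
have cr0 : 0 < c * r.
  by rewrite -invr_gt0 -(pmulr_rgt0 _ (ltr0Sn R 1)) (lt_trans dt0 dtr).
have crdt : c * r < 2 * dt^-1.
  by move: dtr; rewrite ltr_pdivlMr // mulrC -ltr_pdivlMr.
have [_ Ad] := hAB d.
(* The factor [1 - c = 2 tau / beta] is nonnegative, so it may scale [Ad]. The remaining share [c]
   of [<A d, d>] is left to the spectral radius. *)
have tB : (1 - c) * dotv (A *m d) d <= 2 * tau * dotv (B *m d) d.
  have -> : 2 * tau = (1 - c) * beta by rewrite mulrBl cE; ring.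
  rewrite -mulrA ler_wpM2l // /c opprB addrC subrK.
  by rewrite !mulr_ge0 ?invr_ge0 ?ltW.
have cA : c * dotv (A *m d) d <= c * (r * dotv d d).
  by rewrite (ler_wpM2l (ltW c0)) ?dotv_mulmx_le_spectral_radius.
have : c * r * dotv d d < 2 * dt^-1 * dotv d d by rewrite ltr_pM2r ?dotv_gt0.
lra.
Qed.
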